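(* There exists an absolute constant $q > 0$ such that for every integer $n \ge 2$, every axis-aligned cube $\mathcal{C} \subseteq \mathbb{R}^n$ (that is, $\mathcal{C} = \prod_{i=1}^n [a_i, a_i+h]$ with $a \in \mathbb{R}^n$, $h>0$), and every measurable set $K \subseteq \mathbb{R}^n$ with $0 < \mathrm{vol}(K) < \infty$, $$\psi_K \le q \cdot \psi_{\mathcal{C}}.$$
   Context: ''Measurable'' means Borel measurable and $\mathrm{vol}$ is $n$-dimensional Lebesgue measure. For $x \in \mathbb{R}^n$, $\ell_0(x) = \#\{i \in \{1,\dots,n\} : x_i \ne 0\}$. Two sets $A, B \subseteq \mathbb{R}^n$ are axis-disjoint if $\ell_0(x-y) \ge 2$ for all $x \in A$, $y \in B$. For a measurable $K \subseteq \mathbb{R}^n$ with $\mathrm{vol}(K) > 0$, the $\ell_0$-isoperimetric coefficient of $K$ is $$\psi_K := \inf \frac{\mathrm{vol}(K \setminus (S_1 \cup S_2))}{\min\{\mathrm{vol}(S_1), \mathrm{vol}(S_2)\}},$$ the infimum being over all pairs of axis-disjoint measurable sets $S_1, S_2 \subseteq K$ with $\min\{\mathrm{vol}(S_1),\mathrm{vol}(S_2)\} > 0$. *)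

(* Defs.v *)
From HB Require Import structures.
From mathcomp Require Import all_boot all_order all_algebra.
From mathcomp Require Import all_classical all_reals all_analysis.
Set Implicit Arguments.
Unset Strict Implicit.
Unset Printing Implicit Defensive.
Import Order.TTheory GRing.Theory Num.Theory.
Local Open Scope classical_set_scope.
Local Open Scope ring_scope.
Local Open Scope ereal_scope.

(* R^n, with the library's sigma-algebra on tuples: the smallest one making
   all the coordinates Borel measurable, i.e., the Borel sigma-algebra. *)
Notation Rn R n := (n.-tuple (measurableTypeR R)).

Section cons_measure.
Context (R : realType) (n : nat).
Variable m : {sigma_finite_measure set (Rn R n) -> \bar R}.

Definition consRn (p : measurableTypeR R * Rn R n) : Rn R n.+1 :=
  [the n.+1.-tuple _ of p.1 :: p.2].

Lemma measurable_consRn : measurable_fun [set: _] consRn.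
Proof. exact: measurable_cons. Qed.

(* The measure lambda \x m, transported to R^(n+1) = R x R^n. *)
Definition cons_measure : set (Rn R n.+1) -> \bar R :=
  pushforward (@lebesgue_measure R \x m) consRn.

Let cons_measure0 : cons_measure set0 = 0.
Proof. by rewrite /cons_measure /pushforward preimage_set0 measure0. Qed.

Let cons_measure_ge0 A : 0 <= cons_measure A.
Proof. by rewrite /cons_measure /pushforward; exact: measure_ge0. Qed.

Let cons_measure_sigma_additive : semi_sigma_additive cons_measure.
Proof.
pose mf := measurable_consRn.
move=> F mF tF mUF; rewrite /cons_measure /pushforward preimage_bigcup.
apply: measure_semi_sigma_additive.
- by move=> k; rewrite -[X in measurable X]setTI; exact: mf.
- apply/trivIsetP => /= i j _ _ ij; rewrite -preimage_setI.
  by move/trivIsetP : tF => /(_ _ _ _ _ ij) ->//; rewrite preimage_set0.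
- by rewrite -preimage_bigcup -[X in measurable X]setTI; exact: mf.
Qed.

HB.instance Definition _ := isMeasure.Build _ _ _ cons_measure
  cons_measure0 cons_measure_ge0 cons_measure_sigma_additive.

Let cons_measure_sigma_finite : sigma_finite [set: Rn R n.+1] cons_measure.
Proof.
have /sigma_finiteP[F [TF ndF Foo]] := sigma_finiteT (@lebesgue_measure R).
have /sigma_finiteP[G [TG ndG Goo]] := sigma_finiteT m.
pose uncons (x : Rn R n.+1) : measurableTypeR R * Rn R n :=
  (thead x, [tuple of behead x]).
have muncons : measurable_fun [set: Rn R n.+1] uncons.
  apply/measurable_fun_pairP; split; first exact: measurable_tnth.
  exact: measurable_behead.
have consK : cancel consRn uncons.
  by case=> a t; rewrite /uncons /consRn theadE; congr pair; exact/val_inj.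
exists (fun k => uncons @^-1` (F k `*` G k)).
  rewrite -preimage_bigcup; apply/esym; rewrite -subTset => x _.
  have [k _ Fk] : (\bigcup_k F k) (uncons x).1 by rewrite -TF.
  have [l _ Gl] : (\bigcup_k G k) (uncons x).2 by rewrite -TG.
  exists (maxn k l) => //; split.
  - by move: Fk; exact/subsetPset/ndF/leq_maxl.
  - by move: Gl; exact/subsetPset/ndG/leq_maxr.
move=> k; have [mF Fkoo] := Foo k; have [mG Gkoo] := Goo k; split.
  by rewrite -[X in measurable X]setTI; apply: muncons => //; exact: measurableX.
rewrite /cons_measure /pushforward (_ : _ @^-1` _ = F k `*` G k).
  by rewrite product_measure1E// lte_mul_pinfty// ge0_fin_numE.
by rewrite -comp_preimage (_ : uncons \o consRn = id)//; exact/funext.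
Qed.

HB.instance Definition _ := Measure_isSigmaFinite.Build _ _ _ cons_measure
  cons_measure_sigma_finite.

End cons_measure.

(* n-dimensional Lebesgue measure, as the n-fold product of the Lebesgue
   measure on the line. *)
Fixpoint vol (R : realType) (n : nat) :
    {sigma_finite_measure set (Rn R n) -> \bar R} :=
  match n with
  | 0 => @dirac _ (Rn R 0) [tuple] R
  | k.+1 => cons_measure (vol R k)
  end.
Arguments vol {R n}.

Lemma vol_box (R : realType) (n : nat) (A : 'I_n -> set (measurableTypeR R)) :
  (forall i, measurable (A i)) ->
  vol [set x : Rn R n | forall i, A i (tnth x i)] =
  \prod_(i < n) lebesgue_measure (A i).
Proof.
elim: n A => [A _|n IH A mA].
  by rewrite big_ord0 /= diracE mem_set// => -[].
rewrite big_ord_recl -IH//= /cons_measure /pushforward.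
rewrite (_ : _ @^-1` _ =
    A ord0 `*` [set x : Rn R n | forall i, A (lift ord0 i) (tnth x i)]).
  rewrite product_measure1E//.
  rewrite (_ : mkset _ =
      \bigcap_i ((fun x : Rn R n => tnth x i) @^-1` A (lift ord0 i))).
    apply: fin_bigcap_measurable => // i _; rewrite -[X in measurable X]setTI.
    exact: measurable_tnth.
  by apply/seteqP; split=> x Ax i; [move=> _|]; exact: Ax.
apply/seteqP; split=> -[a x] /=.
  move=> Ax; split; first exact: (Ax ord0).
  by move=> i; have := Ax (lift ord0 i); rewrite tnthS.
move=> [Aa Ax] i; case: (unliftP ord0 i) => [j|] ->//.
by rewrite tnthS.
Qed.

(* Tuples carry no group structure, hence an explicit difference. *)
Definition subRn (R : realType) (n : nat) (x y : Rn R n) : Rn R n :=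
  [tuple (tnth x i : R) - tnth y i | i < n]%R.

Definition ell0 (R : realType) (n : nat) (x : Rn R n) : nat :=
  #|[set i : 'I_n | (tnth x i : R) != 0%R]%SET|.

Definition axis_disjoint (R : realType) (n : nat) (A B : set (Rn R n)) : Prop :=
  forall x y, A x -> B y -> (2 <= ell0 (subRn x y))%N.

(* The infimum is taken in the extended reals (+oo if there is no admissible
   pair); when K has finite volume all the ratios are finite. *)
Definition psi (R : realType) (n : nat) (K : set (Rn R n)) : \bar R :=
  ereal_inf [set r | exists S1 S2 : set (Rn R n),
    [/\ measurable S1 /\ measurable S2, S1 `<=` K /\ S2 `<=` K,
        axis_disjoint S1 S2,
        0 < Order.min (vol S1) (vol S2) &
        r = vol (K `\` (S1 `|` S2)) / Order.min (vol S1) (vol S2)]].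

Definition cube (R : realType) (n : nat) (a : Rn R n) (h : R) : set (Rn R n) :=
  [set x | forall i, ((tnth a i : R) <= tnth x i <= (tnth a i : R) + h)%R].

(* Main.v *)
Require Import Defs.
From mathcomp Require Import all_boot all_order all_algebra.
From mathcomp Require Import all_classical all_reals all_analysis.
From mathcomp Require Import measurable_realfun.
From mathcomp Require Import ring lra zify.
Import Order.TTheory GRing.Theory Num.Theory.
Set Implicit Arguments.
Unset Strict Implicit.
Unset Printing Implicit Defensive.
Local Open Scope classical_set_scope.
Local Open Scope ring_scope.

(** Both sides are compared with 1 / sqrt n.

    For a cube of volume V, write A for the complement of S2 and S for the part
    of the cube outside S1 and S2.  Every point of A lying on a common
    axis-parallel line with a point of S2 is in S, and induction on the
    dimension gives vol A * (V - vol A) <= sqrt n * V * vol S, hence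
    psi >= 1 / (2 sqrt n).

    For K of finite volume, cut every axis at a median t_i of K: the cell masses
    form a probability w on {0,1}^n with all marginals equal to 1/2, and a
    separator for the Hamming distance pulls back to axis-disjoint sets.  For a
    center s let N be the Hamming distance to s, and take {N < k}, {N = k},
    {N > k}.  For a uniformly random s, N x - N y is a random walk with as many
    steps as x and y have differences, so its mean absolute value over w * w is
    of order sqrt n for a suitable s, and averaging over k gives a layer with
    w (N = k) = O(1 / sqrt n) * w (N < k) * w (N > k).  The additive loss in
    this argument is harmless for n >= 256; for smaller n two opposite quadrants
    in the first two coordinates have mass at least 1/4 each. *)

(** * Separators in the discrete cube *)

(* A lower bound for the mean of |z + X| where X is a sum of independent
   variables uniform on {c_i, - c_i} and V = sum c_i^2: it comes from |u| >= u^2 - u^4 / 4 at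
   u = (z + X) / l and from E X^4 <= 3 V^2. *)
Definition khinchine_potential (R : realType) (l z V : R) : R :=
  (z ^+ 2 + V) / l - (z ^+ 4 + 6 * z ^+ 2 * V + 3 * V ^+ 2) / (4 * l ^+ 3).

(** At [V = 0] the potential is [|z| (u - u^3 / 4)] with [u = |z| / l], and [u - u^3 / 4 < 1] for
    [u >= 0]. *)
Lemma khinchine_potential_le_norm (R : realType) (l z : R) : 0 < l ->
  khinchine_potential l z 0 <= `|z|.
Proof.
move=> l0; have -> : khinchine_potential l z 0 =
    `|z| * ((`|z| / l) - (`|z| / l) ^+ 3 / 4).
  have -> : khinchine_potential l z 0 = khinchine_potential l `|z| 0.
    have e : `|z| ^+ 2 = z ^+ 2 by rewrite real_normK// num_real.
    by rewrite /khinchine_potential (exprM z 2 2) (exprM `|z| 2 2) e.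
  by rewrite /khinchine_potential; field; lra.
have : 0 <= `|z| / l by rewrite divr_ge0// ltW.
have := normr_ge0 z; move: (`|z| / l) => u z0 u0.
rewrite ler_piMr//.
(* 6/5 is close to the minimizer 2 / sqrt 3 of u^3 / 4 - u. *)
have : 0 <= (u - 6 / 5) ^+ 2 * (u + 12 / 5) by rewrite mulr_ge0 ?sqr_ge0; lra.
have -> : (u - 6 / 5) ^+ 2 * (u + 12 / 5) =
  u ^+ 3 - 108 / 25 * u + 432 / 125 by field.
lra.
Qed.

(** The quadratic terms average exactly; the coefficients 6 and 3 make the quartic terms agree up to
    [c^4 / l^3], which has the right sign. *)
Lemma khinchine_potential_step (R : realType) (l z c V : R) : 0 < l ->
  khinchine_potential l z (c ^+ 2 + V) *+ 2 <=
  khinchine_potential l (z + c) V + khinchine_potential l (z - c) V.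
Proof.
move=> l0; rewrite -subr_ge0.
have -> : khinchine_potential l (z + c) V + khinchine_potential l (z - c) V -
    khinchine_potential l z (c ^+ 2 + V) *+ 2 = c ^+ 4 / l ^+ 3.
  by rewrite /khinchine_potential; field; lra.
by apply: divr_ge0; [exact: exprn_even_ge0|rewrite exprn_ge0 ?ltW].
Qed.

(* Method of conditional expectations: by [khinchine_potential_step] one of the
   two values of each sign does not decrease the total potential. *)
Lemma exists_signs (R : realType) (T : finType) (w : T -> R) (l : R) (n : nat)
    (c : T -> 'I_n -> R) (z : T -> R) :
  (forall t, 0 <= w t) -> 0 < l ->
  exists s : 'I_n -> bool,
    \sum_t w t * khinchine_potential l (z t) (\sum_i c t i ^+ 2) <=
    \sum_t w t * `|z t + \sum_i (-1) ^+ s i * c t i|.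
Proof.
move=> w0 l0; elim: n c z => [c z|n IH c z].
  exists xpredT; apply: ler_sum => t _; rewrite !big_ord0 addr0.
  by rewrite ler_wpM2l// khinchine_potential_le_norm.
pose c' t i := c t (lift ord0 i).
pose S (e : bool) := \sum_t w t *
  khinchine_potential l (z t + (-1) ^+ e * c t ord0) (\sum_i c' t i ^+ 2).
have [e He] : exists e, \sum_t w t *
    khinchine_potential l (z t) (\sum_i c t i ^+ 2) <= S e.
  have H : (\sum_t w t * khinchine_potential l (z t) (\sum_i c t i ^+ 2)) *+ 2
      <= S false + S true.
    rewrite -sumrMnl -big_split/=; apply: ler_sum => t _.
    rewrite -mulrnAr -mulrDr ler_wpM2l// big_ord_recl expr0 expr1 mul1r mulN1r.
    exact: khinchine_potential_step.
  have [H1|H1] := leP (\sum_t w t *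
    khinchine_potential l (z t) (\sum_i c t i ^+ 2)) (S false).
    by exists false.
  by exists true; lra.
have [s Hs] := IH c' (fun t => z t + (-1) ^+ e * c t ord0).
exists (fun i => if unlift ord0 i is Some j then s j else e).
apply: le_trans He _; apply: le_trans Hs _.
rewrite le_eqVlt; apply/orP; left; apply/eqP; apply: eq_bigr => t _.
rewrite big_ord_recl unlift_none addrA; congr (_ * `|_ + _|).
by apply: eq_bigr => i _; rewrite liftK.
Qed.

(** Number of layers strictly between two values; truncated subtraction makes it 0 unless
    [a < b]. *)
Lemma sum_layers_between (R : realType) (n a b : nat) : (b <= n)%N ->
  \sum_(k < n.+1) (a < k)%:R * (k < b)%:R = (b - a.+1)%:R :> R.
Proof.
elim: n b => [|n IH] b bn.
  have -> : b = 0%N by lia.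
  by rewrite big_ord_recl big_ord0/= mul0r addr0 sub0n.
rewrite big_ord_recr/=; have [bn1|bn1] := leqP b n.
  by rewrite IH// [(n.+1 < b)%N](_ : _ = false) ?mulr0 ?addr0//; lia.
have {bn bn1}-> : b = n.+1 by lia.
rewrite ltnn mulr0 addr0 -[RHS](_ : (n - a.+1)%:R + (a < n)%:R = _); last first.
  by rewrite -natrD; congr _%:R; have [] := ltnP a n; lia.
rewrite -IH// !big_ord_recr/= ltnn mulr0 addr0 ltnS leqnn mulr1; congr (_ + _).
by apply: eq_bigr => i _; congr (_ * _); rewrite !ltn_ord ltnS (ltnW (ltn_ord i)).
Qed.

(** Integers at distance [d >= 1] have only [d - 1] integers strictly between them: this is the
    source of the additive loss. *)
Lemma natr_dist_le (R : realType) (a b : nat) :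
  `|a%:R - b%:R| - 1 <= (b - a.+1)%:R + (a - b.+1)%:R :> R.
Proof.
have [ab|ab] := leqP a b.
  rewrite distrC ger0_norm ?subr_ge0 ?ler_nat// -natrB//.
  rewrite lerBlDr -natrD natr1 ler_nat; lia.
rewrite ger0_norm ?subr_ge0 ?ler_nat 1?ltnW// -natrB 1?ltnW//.
rewrite lerBlDr -natrD natr1 ler_nat; lia.
Qed.

(* Discrete coarea: the layers {N = k} have total mass 1, while the products
   of the masses of the two sides add up to the mean gap between two values. *)
Lemma exists_light_layer (R : realType) (T : finType) (w : T -> R)
    (N : T -> nat) (n : nat) (g : R) :
  (forall t, 0 <= w t) -> \sum_t w t = 1 -> (forall t, N t <= n)%N -> 0 < g ->
  2 * g + 1 <= \sum_t \sum_u w t * w u * `|(N t)%:R - (N u)%:R| ->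
  exists k : nat,
    0 < (\sum_(t | (N t < k)%N) w t) * (\sum_(t | (k < N t)%N) w t) /\
    g * (\sum_(t | N t == k) w t) <=
    (\sum_(t | (N t < k)%N) w t) * (\sum_(t | (k < N t)%N) w t).
Proof.
move=> w0 w1 Nn g0 gap.
pose A k := (\sum_(t | (N t < k)%N) w t) * (\sum_(t | (k < N t)%N) w t).
pose B k := \sum_(t | N t == k) w t.
have A0 k : 0 <= A k by rewrite mulr_ge0// sumr_ge0.
have sumB : \sum_(k < n.+1) B k = 1.
  rewrite -w1 (partition_big (fun t => inord (N t) : 'I_n.+1) predT)//=.
  apply: eq_bigr => k _; apply: eq_bigl => t.
  by rewrite -val_eqE/= inordK// ltnS.
have AE k : A k = \sum_t \sum_u w t * w u * ((N t < k)%:R * (k < N u)%:R).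
  rewrite /A big_mkcond [X in _ * X]big_mkcond big_distrlr/=.
  apply: eq_bigr => t _; apply: eq_bigr => u _.
  by case: ltnP => _; case: ltnP => _; rewrite /= ?(mulr0, mul0r, mulr1).
have sumA : \sum_(k < n.+1) A k =
    \sum_t \sum_u w t * w u * (N u - (N t).+1)%:R.
  under eq_bigr do rewrite AE.
  rewrite exchange_big; apply: eq_bigr => t _.
  rewrite exchange_big; apply: eq_bigr => u _.
  by rewrite -mulr_sumr sum_layers_between.
have ww : \sum_t \sum_u w t * w u = 1.
  by rewrite -big_distrlr/= w1 mulr1.
(* After symmetrizing in [t] and [u], each pair contributes at least its gap minus 1; the weights
   sum to 1, which uses up the [+ 1] of the hypothesis. *)
have gA : g <= \sum_(k < n.+1) A k.
  suff : 2 * g + 1 - 1 <= (\sum_(k < n.+1) A k) *+ 2 by lra.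
  apply: le_trans (lerB gap (lexx _)) _; rewrite -[X in _ - X]ww sumA mulr2n.
  rewrite [X in _ <= _ + X]exchange_big -big_split/= -sumrB; apply: ler_sum => t _.
  rewrite -big_split/= -sumrB; apply: ler_sum => u _.
  rewrite [w u * w t]mulrC -mulrDr -[X in _ - X]mulr1 -mulrBr ler_wpM2l//.
    by rewrite mulr_ge0.
  exact: natr_dist_le.
have [k Ak] : exists k : 'I_n.+1, 0 < A k /\ g * B k <= A k.
  apply: contrapT => nex.
  suff : \sum_(k < n.+1) A k < g.
    by rewrite ltNge gA.
  (* Without a good layer this holds for all [k], strictly unless both sides vanish; since [B] sums
     to 1, the sum of [A] would drop below [g]. *)
  have AB (k : 'I_n.+1) : A k <= g * B k ?= iff (A k == 0) && (B k == 0).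
    have B0 : 0 <= B k by apply: sumr_ge0 => t _; exact: w0.
    have [Ak0|Ak0] := eqVneq (A k) 0.
      split; first by rewrite Ak0 mulr_ge0// ltW.
      by rewrite Ak0 eq_sym mulf_eq0 gt_eqF.
    have : A k < g * B k.
      rewrite ltNge; apply/negP => h; apply: nex; exists k; split=> //.
      by rewrite lt_neqAle eq_sym Ak0 A0.
    by move=> h; split; [exact: ltW|rewrite lt_eqF].
  have [le eqE] := leif_sum (fun k (_ : predT k) => AB k).
  rewrite -mulr_sumr sumB mulr1 in le eqE.
  rewrite lt_neqAle le eqE andbT; apply/negP => /forallP all0.
  have : \sum_(k < n.+1) A k = 0.
    by apply: big1 => k _; have /andP[/eqP] := all0 k.
  by move=> A00; move: gA; rewrite A00 leNgt g0.
by exists k.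
Qed.

(** * Hamming distance and balanced weights on {0,1}^n *)

Definition hdist (n : nat) (b c : {ffun 'I_n -> bool}) : nat :=
  \sum_(i < n) (b i != c i).

Lemma hdist_triangle (n : nat) (b c d : {ffun 'I_n -> bool}) :
  (hdist b d <= hdist b c + hdist c d)%N.
Proof.
rewrite /hdist -big_split; apply: leq_sum => i _ /=.
by case: (b i); case: (c i); case: (d i).
Qed.

Lemma hdist_le (n : nat) (b c : {ffun 'I_n -> bool}) : (hdist b c <= n)%N.
Proof.
rewrite -[X in (_ <= X)%N]card_ord -sum1_card; apply: leq_sum => i _.
by case: (b i != c i).
Qed.

(** Coordinate [i] contributes the bit difference, reversed when [s i] is true; a choice of center
    is thus a choice of signs. *)
Lemma hdistB (R : realType) (n : nat) (b c s : {ffun 'I_n -> bool}) :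
  (hdist b s)%:R - (hdist c s)%:R =
  \sum_i (-1) ^+ s i * ((b i)%:R - (c i)%:R) :> R.
Proof.
rewrite /hdist !natr_sum -sumrB; apply: eq_bigr => i _.
by case: (b i); case: (c i); case: (s i) => /=; rewrite ?expr0 ?expr1; ring.
Qed.

Section separator.
Context (R : realType) (n : nat) (w : {ffun 'I_n -> bool} -> R).
Hypothesis w0 : forall b, 0 <= w b.
Hypothesis w1 : \sum_b w b = 1.
Hypothesis balanced : forall i, \sum_(b : {ffun 'I_n -> bool} | b i) w b = 1 / 2.

Let mean_bit i : \sum_(b : {ffun 'I_n -> bool}) w b * (b i)%:R = 1 / 2 :> R.
Proof.
rewrite -(balanced i) [RHS]big_mkcond; apply: eq_bigr => b _.
by case: (b i); rewrite ?mulr1 ?mulr0.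
Qed.

(** Two independent samples of [w] have independent fair bits at [i], so they differ there with
    probability 1/2. *)
Lemma balanced_mean_dist :
  \sum_b \sum_c w b * w c * \sum_i ((b i)%:R - (c i)%:R) ^+ 2 = n%:R / 2 :> R.
Proof.
under eq_bigr => b _.
  under eq_bigr do rewrite mulr_sumr.
  rewrite exchange_big/=; over.
rewrite exchange_big/= -[n in RHS]card_ord -sum1_card natr_sum mulr_suml.
apply: eq_bigr => i _.
transitivity (\sum_b w b * (1 / 2)); last by rewrite -mulr_suml w1 mul1r div1r.
apply: eq_bigr => b _.
(* Bits satisfy [(x - y)^2 = x + y - 2 x y]. *)
transitivity (\sum_c (w b * (b i)%:R * w c +
    (w b - 2 * (w b * (b i)%:R)) * (w c * (c i)%:R))).
  by apply: eq_bigr => c _; case: (b i); case: (c i) => /=; ring.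
by rewrite big_split/= -!mulr_sumr w1 mean_bit; field.
Qed.

(** At scale [l = sqrt n], the number [V <= l^2] of differing bits has potential
    [V / l - 3 V^2 / (4 l^3) >= V / (4 l)]. As [V] has mean [n / 2], this averages to at least
    [sqrt n / 8]. *)
Lemma exists_wide_center : (0 < n)%N -> exists s : {ffun 'I_n -> bool},
  Num.sqrt n%:R / 8 <=
  \sum_b \sum_c w b * w c * `|(hdist b s)%:R - (hdist c s)%:R|.
Proof.
move=> n0; pose l : R := Num.sqrt n%:R.
have l0 : 0 < l by rewrite sqrtr_gt0 ltr0n.
have ll : l ^+ 2 = n%:R by rewrite sqr_sqrtr ?ler0n.
pose W (t : {ffun 'I_n -> bool} * {ffun 'I_n -> bool}) := w t.1 * w t.2.
pose C (t : {ffun 'I_n -> bool} * {ffun 'I_n -> bool}) (i : 'I_n) : R :=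
  (t.1 i)%:R - (t.2 i)%:R.
have W0 t : 0 <= W t by rewrite mulr_ge0.
have [s Hs] := exists_signs C (fun=> 0) W0 l0.
exists [ffun i => s i]; rewrite pair_bigA/=.
have -> : \sum_p w p.1 * w p.2 *
    `|(hdist p.1 [ffun i => s i])%:R - (hdist p.2 [ffun i => s i])%:R| =
    \sum_t W t * `|0 + \sum_i (-1) ^+ s i * C t i|.
  apply: eq_bigr => t _; rewrite hdistB add0r; congr (_ * `|_|).
  by apply: eq_bigr => i _; rewrite ffunE.
apply: le_trans Hs.
have -> : Num.sqrt n%:R / 8 = \sum_t W t * ((\sum_i C t i ^+ 2) / (4 * l)).
  under [RHS]eq_bigr do rewrite mulrA.
  rewrite -mulr_suml -/l.
  have := balanced_mean_dist; rewrite pair_bigA/= => ->.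
  by rewrite -ll; field; lra.
apply: ler_sum => t _; rewrite ler_wpM2l//.
set V := \sum_i C t i ^+ 2.
have V0 : 0 <= V by apply: sumr_ge0 => i _; exact: sqr_ge0.
have Vn : V <= l ^+ 2.
  rewrite ll -[X in _ <= X%:R]card_ord -sum1_card natr_sum.
  apply: ler_sum => i _; rewrite /C.
  by case: (t.1 i); case: (t.2 i) => /=; lra.
rewrite -subr_ge0; have -> : khinchine_potential l 0 V - V / (4 * l) =
    (3 / 4) * V * (l ^+ 2 - V) / l ^+ 3.
  by rewrite /khinchine_potential; field; lra.
apply: divr_ge0; last by rewrite exprn_ge0// ltW.
by rewrite !mulr_ge0 ?subr_ge0//; lra.
Qed.

Definition separates (P Q : pred {ffun 'I_n -> bool}) : Prop :=
  forall b c, P b -> Q c -> (2 <= hdist b c)%N.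

(** For [g = sqrt n / 32], the condition [2 g + 1 <= sqrt n / 8] amounts to [sqrt n >= 16].
    Distances to [s] on the two sides of layer [k] differ by at least 2, hence so do the points by
    the triangle inequality. *)
Lemma exists_light_separator_large : (256 <= n)%N ->
  exists P Q : pred {ffun 'I_n -> bool}, [/\ separates P Q,
    0 < \sum_(b | P b) w b, 0 < \sum_(b | Q b) w b &
    Num.sqrt n%:R / 32 * \sum_(b | ~~ P b && ~~ Q b) w b <=
      (\sum_(b | P b) w b) * (\sum_(b | Q b) w b)].
Proof.
move=> n256; have n0 : (0 < n)%N by lia.
have sq16 : 16 <= Num.sqrt n%:R :> R.
  rewrite -[X in X <= _]ger0_norm// -sqrtr_sqr ler_wsqrtr//.
  by rewrite -natrX ler_nat.
have [s Hs] := exists_wide_center n0.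
have g0 : 0 < Num.sqrt n%:R / 32 :> R by lra.
have gap : 2 * (Num.sqrt n%:R / 32) + 1 <=
    \sum_b \sum_c w b * w c * `|(hdist b s)%:R - (hdist c s)%:R|.
  by apply: le_trans Hs; lra.
have [k [k0 kg]] := exists_light_layer w0 w1 (fun b => hdist_le b s) g0 gap.
exists (fun b => hdist b s < k)%N, (fun b => k < hdist b s)%N.
have wP : 0 <= \sum_(b | (hdist b s < k)%N) w b by exact: sumr_ge0.
have wQ : 0 <= \sum_(b | (k < hdist b s)%N) w b by exact: sumr_ge0.
split.
- move=> b c /= bk kc; have := hdist_triangle c b s.
  have -> : hdist c b = hdist b c by apply: eq_bigr => i _; rewrite eq_sym.
  by lia.
- by rewrite lt_neqAle wP andbT eq_sym; apply: contraTneq k0 => ->; rewrite mul0r ltxx.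
- by rewrite lt_neqAle wQ andbT eq_sym; apply: contraTneq k0 => ->; rewrite mulr0 ltxx.
- apply: le_trans kg; rewrite ler_wpM2l ?(ltW g0)// le_eqVlt; apply/orP; left.
  by apply/eqP/eq_bigl => b; lia.
Qed.

(** Marginals 1/2 give opposite quadrants equal mass, and two adjacent quadrants total 1/2; so one
    of the two opposite pairs has masses at least 1/4. *)
Lemma exists_quarter_separator : (2 <= n)%N ->
  exists P Q : pred {ffun 'I_n -> bool}, [/\ separates P Q,
    1 / 4 <= \sum_(b | P b) w b & 1 / 4 <= \sum_(b | Q b) w b].
Proof.
move=> n2; have n1 : (1 < n)%N by []; have n0 : (0 < n)%N by lia.
pose i := Ordinal n0; pose j := Ordinal n1.
pose P (x y : bool) (b : {ffun 'I_n -> bool}) := (b i == x) && (b j == y).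
pose W x y := \sum_(b | P x y b) w b.
have sepP x y : separates (P x y) (P (~~ x) (~~ y)).
  move=> b c /andP[/eqP bi /eqP bj] /andP[/eqP ci /eqP cj].
  rewrite /hdist (bigD1 i)//= (bigD1 j)//= bi bj ci cj.
  by case: x {bi ci}; case: y {bj cj}.
have Wi x : W x true + W x false = 1 / 2.
  have Wt : W true true + W true false = 1 / 2.
    rewrite -(balanced i) [RHS](bigID (fun b : {ffun 'I_n -> bool} => b j))/=.
    by congr (_ + _); apply: eq_bigl => b; rewrite /P; case: (b i); case: (b j).
  case: x => //; have := w1.
  rewrite (bigID (fun b : {ffun 'I_n -> bool} => b i))/= balanced.
  rewrite (bigID (fun b : {ffun 'I_n -> bool} => b j))/=.
  have -> : \sum_(b : {ffun 'I_n -> bool} | ~~ b i && b j) w b = W false true.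
    by apply: eq_bigl => b; rewrite /P; case: (b i); case: (b j).
  have -> : \sum_(b : {ffun 'I_n -> bool} | ~~ b i && ~~ b j) w b = W false false.
    by apply: eq_bigl => b; rewrite /P; case: (b i); case: (b j).
  lra.
have Wj : W true true + W false true = 1 / 2.
  rewrite -(balanced j) [RHS](bigID (fun b : {ffun 'I_n -> bool} => b i))/=.
  by congr (_ + _); apply: eq_bigl => b; rewrite /P; case: (b i); case: (b j).
have := Wi true; have := Wi false => Wf Wt.
have [h|h] := leP (1 / 4) (W true true).
  exists (P true true), (P false false); split; [exact: sepP|exact: h|].
  by rewrite -/(W _ _); lra.
exists (P true false), (P false true); split; first exact: sepP.
  by rewrite -/(W _ _); lra.
by rewrite -/(W _ _); lra.
Qed.

Lemma exists_light_separator : (2 <= n)%N ->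
  exists P Q : pred {ffun 'I_n -> bool}, [/\ separates P Q,
    0 < \sum_(b | P b) w b, 0 < \sum_(b | Q b) w b &
    Num.sqrt n%:R * \sum_(b | ~~ P b && ~~ Q b) w b <=
      32 * Num.min (\sum_(b | P b) w b) (\sum_(b | Q b) w b)].
Proof.
move=> n2.
(* [P] and [Q] are disjoint, since a point is at distance 0 from itself. *)
have parts (P Q : pred {ffun 'I_n -> bool}) : separates P Q ->
    \sum_(b | P b) w b + \sum_(b | Q b) w b +
    \sum_(b | ~~ P b && ~~ Q b) w b = 1.
  move=> sep; rewrite -w1 [RHS](bigID P)/= [X in _ = _ + X](bigID Q)/= addrA.
  congr (_ + _ + _); apply: eq_bigl => b; case Qb : (Q b); rewrite ?andbF ?andbT//.
  case Pb : (P b) => //=; have := sep _ _ Pb Qb.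
  by rewrite /hdist big1// => i _; rewrite eqxx.
have [n256|n256] := leqP 256 n.
  have [P [Q [sep P0 Q0 PQ]]] := exists_light_separator_large n256.
  exists P, Q; split=> //; have := parts _ _ sep.
  have : 0 <= \sum_(b | ~~ P b && ~~ Q b) w b by exact: sumr_ge0.
  move: P0 Q0 PQ.
  move: (\sum_(b | P b) w b) (\sum_(b | Q b) w b)
    (\sum_(b | ~~ P b && ~~ Q b) w b) => p q r p0 q0 pqr r0 s1.
  (* Both masses are at most 1, so [p * q] is at most their minimum. *)
  rewrite minEle; case: ifP => _; nra.
have [P [Q [sep P4 Q4]]] := exists_quarter_separator n2.
exists P, Q; split=> //; [lra|lra|].
have sq16 : Num.sqrt n%:R <= 16 :> R.
  rewrite -[X in _ <= X]ger0_norm// -sqrtr_sqr ler_wsqrtr//.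
  by rewrite -natrX ler_nat ltnW.
have := parts _ _ sep; have := sqrtr_ge0 (n%:R : R).
have : 0 <= \sum_(b | ~~ P b && ~~ Q b) w b by exact: sumr_ge0.
move: P4 Q4 sq16.
move: (\sum_(b | P b) w b) (\sum_(b | Q b) w b)
    (\sum_(b | ~~ P b && ~~ Q b) w b) => p q r p0 q0.
move: (Num.sqrt _) => s s16 r0 s0 s1.
(* Here [r <= 1/2], so [s * r <= 8 = 32 * (1/4)]. *)
have : s * r <= 16 * r by rewrite ler_wpM2r.
rewrite minEle; case: ifP => _; lra.
Qed.

End separator.

(** * The cube *)

Lemma measurable_coord (R : realType) (n : nat) (i : 'I_n)
    (A : set (measurableTypeR R)) :
  measurable A -> measurable [set x : Rn R n | A (tnth x i)].
Proof.
by move=> mA; rewrite -[X in measurable X]setTI; exact: measurable_tnth.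
Qed.

Lemma vol_cube (R : realType) (n : nat) (a : Rn R n) (h : R) : 0 < h ->
  vol (cube a h) = (h ^+ n)%:E.
Proof.
move=> h0.
pose A i : set (measurableTypeR R) := `[(tnth a i : R), (tnth a i : R) + h]%classic.
have -> : cube a h = [set x | forall i, A i (tnth x i)].
  by apply/seteqP; split=> x /= + i => /(_ i); rewrite /A /= in_itv.
have mA i : measurable (A i) by exact: measurable_itv.
rewrite (vol_box mA); under eq_bigr => i _.
  rewrite lebesgue_measure_itv/= lte_fin ltrDl h0 -EFinB addrC addKr; over.
by rewrite prodEFin prodr_const card_ord.
Qed.

Lemma measurable_cube (R : realType) (n : nat) (a : Rn R n) (h : R) :
  measurable (cube a h).
Proof.
have -> : cube a h = \bigcap_i ((fun x : Rn R n => tnth x i) @^-1`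
    `[(tnth a i : R), (tnth a i : R) + h]%classic).
  apply/seteqP; split=> [x xa i _|x xa i] /=.
    by rewrite in_itv; exact: xa.
  by have := xa i I; rewrite /= in_itv.
by apply: fin_bigcap_measurable => // i _; exact: measurable_coord.
Qed.

(** * Slices orthogonal to the first axis *)

Definition slice (R : realType) (n : nat) (A : set (Rn R n.+1)) (t : R) :
  set (Rn R n) := [set y | A (consRn (t, y))].

Lemma sliceE (R : realType) (n : nat) (A : set (Rn R n.+1)) (t : R) :
  slice A t = xsection (@consRn R n @^-1` A) t.
Proof.
by apply/seteqP; split=> y; rewrite /xsection /slice /= ?inE//.
Qed.

Lemma measurable_preimage_consRn (R : realType) (n : nat) (A : set (Rn R n.+1)) :
  measurable A -> measurable (@consRn R n @^-1` A).
Proof.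
by move=> mA; rewrite -[X in measurable X]setTI; exact: measurable_consRn.
Qed.

Lemma measurable_slice (R : realType) (n : nat) (A : set (Rn R n.+1)) (t : R) :
  measurable A -> measurable (slice A t).
Proof.
move=> mA; rewrite sliceE; apply: measurable_xsection.
exact: measurable_preimage_consRn.
Qed.

Lemma measurable_fun_vol_slice (R : realType) (n : nat) (A : set (Rn R n.+1)) :
  measurable A ->
  measurable_fun [set: measurableTypeR R] (fun t => vol (slice A t)).
Proof.
move=> mA; under eq_fun do rewrite sliceE.
apply: measurable_fun_xsection.
exact: measurable_preimage_consRn.
Qed.

Lemma vol_slice (R : realType) (n : nat) (A : set (Rn R n.+1)) :
  vol A = (\int[@lebesgue_measure R]_t vol (slice A t))%E.
Proof.
rewrite /= /cons_measure /pushforward /product_measure1.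
by under [RHS]eq_integral do rewrite sliceE.
Qed.

Lemma slice_cube (R : realType) (n : nat) (a0 : measurableTypeR R)
    (a : Rn R n) (h t : R) :
  slice (cube (consRn (a0, a)) h) t =
  [set y | ((a0 : R) <= t <= (a0 : R) + h) /\ cube a h y].
Proof.
apply/seteqP; split=> y /=.
  move=> ya; split; first exact: (ya ord0).
  by move=> i; have := ya (lift ord0 i); rewrite !tnthS.
move=> [ta ya] i; case: (unliftP ord0 i) => [j|] ->//.
by rewrite !tnthS; exact: ya.
Qed.

(** The left side is [F (V - F) + (F - m)^2]. In its square, the first term gives at most
    [n (V s)^2]. The rest is [(F - m)^2 (2 F (V - F) + (F - m)^2) <= (F - m)^2 V^2 <= (V s)^2],
    because [2 F (V - F) + F^2 = V^2 - (V - F)^2]. Thus [n] becomes [n + 1] under the root. *)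
Lemma tangent_pointwise (R : realType) (n : nat) (V F s m : R) :
  0 <= m <= F -> F - m <= s -> F <= V ->
  F * (V - F) <= Num.sqrt n%:R * V * s ->
  F * (V - 2 * m) + m ^+ 2 <= Num.sqrt n.+1%:R * V * s.
Proof.
move=> /andP[m0 mF] Fs FV isoF.
have s0 : 0 <= s by lra.
have V0 : 0 <= V by lra.
have sn : Num.sqrt n%:R ^+ 2 = n%:R :> R by rewrite sqr_sqrtr.
have sn1 : Num.sqrt n.+1%:R ^+ 2 = n%:R + 1 :> R by rewrite sqr_sqrtr// natr1.
rewrite -ler_sqr ?nnegrE; last 2 first.
- by nra.
- by rewrite !mulr_ge0.
have -> : F * (V - 2 * m) + m ^+ 2 = F * (V - F) + (F - m) ^+ 2 by ring.
have le1 : (F * (V - F)) ^+ 2 <= n%:R * (V * s) ^+ 2.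
  rewrite -sn -exprMn mulrA ler_sqr// nnegrE ?mulr_ge0//; lra.
have le2 : V ^+ 2 * (F - m) ^+ 2 <= (V * s) ^+ 2.
  rewrite -exprMn ler_sqr ?nnegrE ?mulr_ge0 ?subr_ge0// ler_wpM2l//.
have le3 : (F - m) ^+ 2 * (2 * (F * (V - F)) + (F - m) ^+ 2) <=
    (F - m) ^+ 2 * V ^+ 2.
  by rewrite ler_wpM2l ?sqr_ge0//; nra.
rewrite -[Num.sqrt _ * V * s]mulrA exprMn sn1.
nra.
Qed.

Lemma le_vol_cube (R : realType) (n : nat) (a : Rn R n) (h : R) (A : set (Rn R n)) :
  0 < h -> measurable A -> A `<=` cube a h ->
  vol A \is a fin_num /\ 0 <= fine (vol A) <= h ^+ n.
Proof.
move=> h0 mA AC.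
have Ale : (vol A <= (h ^+ n)%:E)%E.
  rewrite -(vol_cube a h0); apply: le_measure; rewrite ?inE//.
  exact: measurable_cube.
have fA : vol A \is a fin_num.
  by rewrite ge0_fin_numE ?measure_ge0// (le_lt_trans Ale)// ltry.
split=> //; rewrite fine_ge0 ?measure_ge0//=.
by rewrite -lee_fin fineK.
Qed.

Section slices.
Context (R : realType) (n : nat) (a0 : R) (a : Rn R n) (h : R).
Variable A : set (Rn R n.+1).
Hypotheses (h0 : 0 < h) (mA : measurable A).
Hypothesis AC : A `<=` cube (consRn (a0 : measurableTypeR R, a)) h.

Lemma slice_sub_cube t : slice A t `<=` cube a h.
Proof. by move=> y /AC /(_ (lift ord0 _)) ya i; have := ya i; rewrite !tnthS. Qed.

Lemma le_vol_slice t : vol (slice A t) \is a fin_num /\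
  0 <= fine (vol (slice A t)) <= h ^+ n.
Proof.
by apply: (le_vol_cube h0 _ (@slice_sub_cube t)); exact: measurable_slice.
Qed.

Lemma integrable_vol_slice : (@lebesgue_measure R).-integrable
  `[a0, a0 + h]%classic (EFin \o (fun t => fine (vol (slice A t)))).
Proof.
have -> : EFin \o (fun t : R => fine (vol (slice A t))) = fun t => vol (slice A t).
  by apply/funext => t /=; rewrite fineK//; have [] := le_vol_slice t.
apply: (@le_integrable _ _ _ _ _ _ _ (EFin \o cst (h ^+ n))) => //.
- by apply: measurable_funTS; exact: measurable_fun_vol_slice.
- move=> t _ /=; have [fA /andP[F0 Fh]] := le_vol_slice t.
  by rewrite -(fineK fA) lee_fin !ger0_norm ?exprn_ge0 ?(ltW h0).
- apply: measurable_bounded_integrable => //; last exact: bounded_cst.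
  by rewrite /= lebesgue_measure_itv/= lte_fin ltrDl h0 -EFinB ltry.
Qed.

Lemma fine_vol_slice : fine (vol A) =
  \int[@lebesgue_measure R]_(t in `[a0, a0 + h]%classic) fine (vol (slice A t)).
Proof.
rewrite /Rintegral vol_slice; congr fine; rewrite [RHS]integral_mkcond.
apply: eq_integral => t _; rewrite /patch; case: ifPn => [_|].
  by rewrite fineK//; have [] := le_vol_slice t.
(* Slices outside the first edge of the cube are empty. *)
rewrite notin_setE /= in_itv/= => tD; have -> : slice A t = set0.
  by rewrite -subset0 => y /AC /(_ ord0).
by rewrite measure0.
Qed.

End slices.

Definition differ_in_one (R : realType) (n : nat) (x y : Rn R n) : Prop :=
  exists i, forall j, j != i -> tnth x j = tnth y j.

(* On each slice orthogonal to the first axis the inequality holds by induction,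
   and two slices F(t), F(t') of A differ by at most the slice s(t) of S.
   With m = inf F, concavity of u (V - u) bounds it at the mean of F by its
   tangent at m, that is, by the mean of F (V - F) + (F - m)^2, where F - m <= s. *)
Lemma cube_isoperimetry (R : realType) (n : nat) (a : Rn R n) (h : R)
    (A S : set (Rn R n)) :
  0 < h -> measurable A -> measurable S -> A `<=` cube a h -> S `<=` cube a h ->
  (forall x y, A x -> cube a h y -> ~ A y -> differ_in_one x y -> S x) ->
  fine (vol A) * (h ^+ n - fine (vol A)) <=
  Num.sqrt n%:R * h ^+ n * fine (vol S).
Proof.
move=> h0; elim: n a A S => [a A S mA mS AC SC bd|n IH a A S mA mS].
  (* In dimension 0 the space is a single point, so [A] is empty or has the full volume 1. *)
  rewrite sqrtr0 mul0r mul0r expr0.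
  have [->|/set0P[x Ax]] := eqVneq A set0.
    by rewrite measure0 mul0r.
  have -> : vol A = 1%E.
    have -> : vol A = \d_([tuple] : Rn R 0) A by [].
    by rewrite diracE mem_set// (_ : [tuple] = x)//; exact/esym/tuple0.
  by rewrite subrr mulr0.
have -> : a = consRn ((thead a : measurableTypeR R), [tuple of behead a]).
  by rewrite {1}(tuple_eta a).
move: (thead a) [tuple of behead a] => a0 {}a AC SC bd.
pose D : set (measurableTypeR R) := `[(a0 : R), (a0 : R) + h]%classic.
pose F (t : measurableTypeR R) : R := fine (vol (slice A t)).
pose s (t : measurableTypeR R) : R := fine (vol (slice S t)).
have F_bnd t : 0 <= F t <= h ^+ n by have [] := le_vol_slice h0 mA AC t.
have s_ge0 t : 0 <= s t by have [_ /andP[]] := le_vol_slice h0 mS SC t.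
have V0 : 0 <= h ^+ n by rewrite exprn_ge0// ltW.
have F_iso t : D t ->
    F t * (h ^+ n - F t) <= Num.sqrt n%:R * h ^+ n * s t.
  move=> Dt; apply: (IH a).
  - exact: measurable_slice.
  - exact: measurable_slice.
  - exact: (slice_sub_cube AC).
  - exact: (slice_sub_cube SC).
  - move=> x y Ax Cy nAy [i xy]; apply: (bd _ (consRn (t : measurableTypeR R, y))) => //.
      have : slice (cube (consRn (a0 : measurableTypeR R, a)) h) t y.
        by rewrite slice_cube; split=> //; move: Dt; rewrite /D /= in_itv.
      by [].
    exists (lift ord0 i) => j; case: (unliftP ord0 j) => [k|] ->.
      by rewrite !tnthS => ki; apply: xy; apply: contra_neq ki => ->.
    by [].
(* A point of slice [t] of [A] missing from slice [t'] leaves [A] by a move along the first axis,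
   hence lies in [S]. *)
have F_diff t t' : D t -> D t' -> F t - s t <= F t'.
  move=> Dt Dt'; have [fA _] := le_vol_slice h0 mA AC t.
  have [fA' _] := le_vol_slice h0 mA AC t'.
  have [fS _] := le_vol_slice h0 mS SC t.
  rewrite lerBlDr -lee_fin EFinD !fineK//.
  have msA := measurable_slice t' mA; have msS := measurable_slice t mS.
  apply: (@le_trans _ _ (vol (slice A t' `|` slice S t))); last first.
    exact: measureU2.
  apply: le_measure; rewrite ?inE.
  - exact: measurable_slice.
  - exact: measurableU.
  move=> y Ay; have [A'y|A'y] := pselect (slice A t' y); [by left|right].
  apply: (bd _ (consRn (t' : measurableTypeR R, y))) => //.
    have : slice (cube (consRn (a0 : measurableTypeR R, a)) h) t' y.
      rewrite slice_cube; split; first by move: Dt'; rewrite /D /= in_itv.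
      exact: slice_sub_cube AC _ _ Ay.
    by [].
  exists ord0 => j; case: (unliftP ord0 j) => [k|] ->; last by rewrite eqxx.
  by rewrite !tnthS.
have Da0 : D a0 by rewrite /D /= in_itv/= lexx lerDl ltW.
pose m := inf [set F t | t in D].
have hasinf : has_inf [set F t | t in D].
  split; first by exists (F a0), a0.
  by exists 0 => _ [t _ <-]; have /andP[] := F_bnd t.
have m0 : 0 <= m.
  apply: lb_le_inf; first by exists (F a0), a0.
  by move=> _ [t _ <-]; have /andP[] := F_bnd t.
have mF t : D t -> m <= F t.
  by move=> Dt; apply: ge_inf; [exact: hasinf.2|exists t].
have Fm t : D t -> F t - m <= s t.
  move=> Dt; rewrite lerBlDl -lerBlDr; apply: lb_le_inf; first by exists (F a0), a0.
  by move=> _ [t' Dt' <-]; exact: F_diff.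
have intF := integrable_vol_slice h0 mA AC.
have ints := integrable_vol_slice h0 mS SC.
rewrite (fine_vol_slice h0 mA AC) (fine_vol_slice h0 mS SC) -/F -/s -/D.
set X := Rintegral _ _ _; set Y := Rintegral _ _ _.
have lebD : fine (@lebesgue_measure R D) = h.
  by rewrite /D lebesgue_measure_itv/= lte_fin ltrDl h0 -EFinB addrC addKr.
have lebDfin : (@lebesgue_measure R D < +oo)%E.
  by rewrite /D /= lebesgue_measure_itv/= lte_fin ltrDl h0 -EFinB ltry.
have mD : measurable D by exact: measurable_itv.
have intZ (c : R) (f : measurableTypeR R -> R) :
    (@lebesgue_measure R).-integrable D (EFin \o f) ->
    (@lebesgue_measure R).-integrable D (EFin \o (fun t => c * f t)).
  by move=> intf; exact: (integrableZl mD c intf).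
have intc (c : R) : (@lebesgue_measure R).-integrable D (EFin \o (fun=> c)).
  by apply: measurable_bounded_integrable => //; exact: bounded_cst.
have key : (h ^+ n - 2 * m) * X + m ^+ 2 * h <= Num.sqrt n.+1%:R * h ^+ n * Y.
  rewrite -RintegralZl// -(RintegralZl _ mD ints) -{2}lebD -(Rintegral_cst _ mD).
  rewrite -RintegralD//; last exact: intZ.
  apply: le_Rintegral => //.
  - exact: (integrableD mD (intZ _ _ intF) (intc _)).
  - exact: intZ.
  move=> t Dt; rewrite mulrC; apply: tangent_pointwise.
  - by rewrite m0 mF.
  - exact: Fm.
  - by have /andP[] := F_bnd t.
  - exact: F_iso.
(* With [V = h^n], [X (h V - X) = h ((V - 2 m) X + m^2 h) - (X - m h)^2]: the tangent at [m] lies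
   above the parabola. *)
rewrite exprS.
have : 0 <= (X - m * h) ^+ 2 by exact: sqr_ge0.
have := ler_wpM2l (ltW h0) key.
nra.
Qed.

(** * Lower bound for the coefficient of a cube *)

Lemma differ_in_one_ell0 (R : realType) (n : nat) (x y : Rn R n) :
  differ_in_one x y -> (ell0 (subRn x y) <= 1)%N.
Proof.
move=> [i xy]; rewrite -(cards1 i); apply: subset_leq_card; apply/fintype.subsetP => j.
rewrite !inE tnth_mktuple; apply: contra_neqT => ji.
by rewrite xy// subrr.
Qed.

Lemma cube_axis_disjoint (R : realType) (n : nat) (a : Rn R n) (h : R)
    (S1 S2 : set (Rn R n)) :
  0 < h -> measurable S1 -> measurable S2 ->
  S1 `<=` cube a h -> S2 `<=` cube a h -> axis_disjoint S1 S2 ->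
  fine (vol S2) * (h ^+ n - fine (vol S2)) <=
  Num.sqrt n%:R * h ^+ n * fine (vol (cube a h `\` (S1 `|` S2))).
Proof.
move=> h0 mS1 mS2 S1C S2C dis.
have mC := measurable_cube a h.
have [f2 _] := le_vol_cube h0 mS2 S2C.
have fC : (vol (cube a h) < +oo)%E by rewrite vol_cube// ltry.
(* The product [v (V - v)] is unchanged when [S2] is replaced by its complement, to which
   [cube_isoperimetry] is applied. *)
have -> : fine (vol S2) = h ^+ n - fine (vol (cube a h `\` S2)).
  have -> : vol (cube a h `\` S2) = (vol (cube a h) - vol S2)%E.
    by rewrite measureD// setIidr.
  by rewrite vol_cube// fineB//= subKr.
rewrite subKr mulrC; apply: (@cube_isoperimetry _ _ a) => //.
- exact: measurableD.
- by apply: measurableD => //; exact: measurableU.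
move=> x y [Cx nS2x] Cy nA xy; split=> // -[S1x|//].
have S2y : S2 y by apply: contrapT => nS2y; exact: nA.
by have := dis _ _ S1x S2y; rewrite ltnNge differ_in_one_ell0.
Qed.

Lemma axis_disjointC (R : realType) (n : nat) (S1 S2 : set (Rn R n)) :
  axis_disjoint S1 S2 -> axis_disjoint S2 S1.
Proof.
move=> dis x y S2x S1y; have := dis _ _ S1y S2x.
rewrite /ell0; congr (_ <= _)%N; apply: eq_card => i.
by rewrite !inE !tnth_mktuple !subr_eq0 eq_sym.
Qed.

Lemma psi_cube_ge (R : realType) (n : nat) (a : Rn R n) (h : R) :
  (0 < n)%N -> 0 < h ->
  (((2 * Num.sqrt n%:R)^-1)%:E <= psi (cube a h))%E.
Proof.
move=> n0 h0; apply: le_ereal_inf_tmp => _ [S1 [S2 [[mS1 mS2] [S1C S2C] dis min0 ->]]].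
have [f1 /andP[p1 le1]] := le_vol_cube h0 mS1 S1C.
have [f2 /andP[p2 le2]] := le_vol_cube h0 mS2 S2C.
have iso2 := cube_axis_disjoint h0 mS1 mS2 S1C S2C dis.
have iso1 := cube_axis_disjoint h0 mS2 mS1 S2C S1C (axis_disjointC dis).
rewrite setUC in iso1.
have mS3 : measurable (cube a h `\` (S1 `|` S2)).
  by apply: measurableD; [exact: measurable_cube|exact: measurableU].
have [f3 /andP[p3 _]] := le_vol_cube h0 mS3 (@subDsetl _ _ _).
rewrite -(fineK f1) -(fineK f2) -EFin_min lte_fin in min0.
rewrite -(fineK f1) -(fineK f2) -(fineK f3) -EFin_min.
rewrite inver gt_eqF// -EFinM lee_fin.
have s0 : 0 < Num.sqrt n%:R :> R by rewrite sqrtr_gt0 ltr0n.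
have V0 : 0 < h ^+ n by rewrite exprn_gt0.
rewrite ler_pdivlMr// ler_pdivrMl ?mulr_gt0//.
set v1 := fine (vol S1) in p1 le1 iso1 *; set v2 := fine (vol S2) in p2 le2 iso2 *.
set v3 := fine (vol (_ `\` _)) in p3 iso1 iso2 *.
(* For [v <= V / 2] the factor [V - v] is at least [V / 2]. Disjointness of [S1] and [S2] ensures
   that one of them is that small. *)
have half v : v <= h ^+ n / 2 -> 0 <= v ->
    v * (h ^+ n - v) <= Num.sqrt n%:R * h ^+ n * v3 ->
    v <= 2 * Num.sqrt n%:R * v3.
  move=> vV v0 iso; rewrite -(ler_pM2l V0).
  have : 0 <= v * (h ^+ n / 2 - v) by rewrite mulr_ge0 ?subr_ge0.
  nra.
have [h1|h1] := leP v1 ((h ^+ n) / 2).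
  by rewrite ge_min half.
have dis0 : S1 `&` S2 = set0.
  rewrite -subset0 => x [S1x S2x]; have := dis _ _ S1x S2x.
  suff -> : ell0 (subRn x x) = 0%N by [].
  by apply: eq_card0 => i; rewrite !inE tnth_mktuple subrr eqxx.
rewrite ge_min orbC half//.
suff : v1 + v2 <= h ^+ n by lra.
have mS12 := measurableU _ _ mS1 mS2.
have S12C : S1 `|` S2 `<=` cube a h by move=> x [/S1C|/S2C].
have [_ /andP[_]] := le_vol_cube h0 mS12 S12C.
by rewrite measureU// fineD.
Qed.

(** * Medians and arbitrary sets of finite volume *)

(** A box with one factor of length 0. This excludes jumps of the distribution function of a
    coordinate, so that exact medians exist. *)
Lemma vol_hyperplane (R : realType) (n : nat) (i : 'I_n) (t : R) :
  vol [set x : Rn R n | (tnth x i : R) = t] = 0%E.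
Proof.
pose A j : set (measurableTypeR R) := if j == i then [set t] else setT.
have mA j : measurable (A j) by rewrite /A; case: ifP.
have -> : [set x : Rn R n | (tnth x i : R) = t] =
    [set x | forall j, A j (tnth x j)].
  apply/seteqP; split=> x /=.
    by move=> xt j; rewrite /A; case: eqVneq => [->|].
  by move=> /(_ i); rewrite /A eqxx.
by rewrite (vol_box mA) (bigD1 i)//= /A eqxx lebesgue_measure_set1 mul0e.
Qed.

Lemma measure_preimage_fintype d (T : measurableType d) (R : realType)
    (mu : {measure set T -> \bar R}) (I : finType) (K : set T) (B : T -> I)
    (P : pred I) :
  (forall i, measurable (K `&` [set x | B x = i])) ->
  mu (K `&` [set x | P (B x)]) = (\sum_(i | P i) mu (K `&` [set x | B x = i]))%E.
Proof.
move=> mB; pose F i := if P i then K `&` [set x | B x = i] else set0.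
have mF i : measurable (F i) by rewrite /F; case: ifP.
have -> : K `&` [set x | P (B x)] = \bigcup_i F i.
  apply/seteqP; split=> [x [Kx Px]|x [i _]]; first by exists (B x); rewrite // /F Px.
  by rewrite /F; case: ifP => // Pi [Kx /= xi]; split=> //=; rewrite xi.
rewrite measure_fin_bigcup//.
- have -> : [set: I] = [set` enum I].
    by apply/seteqP; split=> // i _; rewrite /= mem_enum.
  rewrite -fsbig_seq ?enum_uniq// big_enum/= [RHS]big_mkcond.
  by apply: eq_bigr => i _; rewrite /F; case: ifP; rewrite ?measure0.
- exact: finite_finset.
- move=> i j _ _ [x []]; rewrite /F.
  case: ifP => // _ [_ /= xi]; case: ifP => // _ [_ /= xj].
  by rewrite -xi -xj.
Qed.

Lemma measurable_coord_le (R : realType) (n : nat) (K : set (Rn R n)) (i : 'I_n) (t : R) :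
  measurable K -> measurable (K `&` [set x | (tnth x i : R) <= t]).
Proof.
move=> mK; apply: measurableI => //.
have := @measurable_coord _ _ i _ (measurable_itv `]-oo, t]).
by congr measurable; apply/seteqP; split=> x /=; rewrite in_itv.
Qed.

Section median.
Context (R : realType) (n : nat) (K : set (Rn R n)) (i : 'I_n).
Hypotheses (mK : measurable K) (K0 : (0 < vol K)%E) (Koo : (vol K < +oo)%E).

Let G (t : R) := vol (K `&` [set x | (tnth x i : R) <= t]).

Let half_vol := (fine (vol K) / 2)%:E.

Let half_gt0 : (0 < half_vol)%E.
Proof. by rewrite lte_fin divr_gt0// fine_gt0// K0. Qed.

Let half_lt : (half_vol < vol K)%E.
Proof.
have fK : vol K \is a fin_num by rewrite ge0_fin_numE.
rewrite -[X in (_ < X)%E](fineK fK); have := half_gt0; rewrite !lte_fin; lra.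
Qed.

Let G_le (t u : R) : t <= u -> (G t <= G u)%E.
Proof.
move=> tu; apply: le_measure; rewrite ?inE; [exact: measurable_coord_le..|].
by move=> x [Kx /= xt]; split=> //=; exact: le_trans xt tu.
Qed.

Let G_lt_oo (t : R) : (G t < +oo)%E.
Proof.
apply: le_lt_trans Koo; apply: le_measure; rewrite ?inE//.
exact: measurable_coord_le.
Qed.

(** Continuity of the volume from above, available because [G] is finite; [G_incr] is the
    counterpart from below. *)
Let G_decr (u : R^nat) (A : set (Rn R n)) (c : \bar R) :
  nonincreasing_seq u -> \bigcap_k (K `&` [set x | (tnth x i : R) <= u k]) = A ->
  (forall k, c <= G (u k))%E -> (c <= vol A)%E.
Proof.
move=> du <- cG.
have cv : (G \o u) @ \oo --> vol (\bigcap_k (K `&` [set x | (tnth x i : R) <= u k])).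
  apply: nonincreasing_cvg_mu.
  - exact: G_lt_oo.
  - by move=> k; exact: measurable_coord_le.
  - by apply: bigcap_measurable => [|k _]; [exists 0%N|exact: measurable_coord_le].
  - move=> k l kl; apply/subsetPset => x [Kx /= xl]; split=> //=.
    exact: le_trans xl (du _ _ kl).
rewrite -(cvg_lim _ cv)//; apply: lime_ge; first by apply/cvg_ex; eexists; exact: cv.
by apply: nearW => k; exact: cG.
Qed.

Let G_incr (u : R^nat) (A : set (Rn R n)) (c : \bar R) :
  nondecreasing_seq u -> \bigcup_k (K `&` [set x | (tnth x i : R) <= u k]) = A ->
  (forall k, G (u k) <= c)%E -> (vol A <= c)%E.
Proof.
move=> du <- cG.
have cv : (G \o u) @ \oo --> vol (\bigcup_k (K `&` [set x | (tnth x i : R) <= u k])).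
  apply: nondecreasing_cvg_mu.
  - by move=> k; exact: measurable_coord_le.
  - by apply: bigcup_measurable => k _; exact: measurable_coord_le.
  - move=> k l kl; apply/subsetPset => x [Kx /= xl]; split=> //=.
    exact: le_trans xl (du _ _ kl).
rewrite -(cvg_lim _ cv)//; apply: lime_le; first by apply/cvg_ex; eexists; exact: cv.
by apply: nearW => k; exact: cG.
Qed.

Lemma exists_median : exists t : R,
  vol (K `&` [set x | (tnth x i : R) <= t]) = (fine (vol K) / 2)%:E.
Proof.
pose A := [set t | (G t <= half_vol)%E].
have [t0 At0] : A !=set0.
  apply: contrapT => /set0P/negP; rewrite negbK => /eqP A0.
  suff : (half_vol <= vol (set0 : set (Rn R n)))%E.
    by rewrite measure0 leNgt half_gt0.
  apply: (@G_decr (fun k => - k%:R)).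
  - by move=> k l kl; rewrite lerN2 ler_nat.
  - rewrite -subset0 => x xk; have [_ /=] := xk (Num.bound `|(tnth x i : R)|) I.
    apply/negP; rewrite -ltNge ltrNl.
    by rewrite (le_lt_trans (ler_norm _))// normrN archi_boundP.
  - move=> k; apply: ltW; rewrite ltNge; apply/negP => Gk.
    by have : A (- k%:R) by []; rewrite A0.
have [k0 Gk0] : exists k : nat, (half_vol < G k%:R)%E.
  apply: contrapT => /forallNP Gk.
  suff : (vol K <= half_vol)%E by rewrite leNgt half_lt.
  apply: (@G_incr (fun k => k%:R)).
  - by move=> k l kl; rewrite ler_nat.
  - apply/seteqP; split=> [x [k _ []]//|x Kx].
    exists (Num.bound `|(tnth x i : R)|) => //; split=> //=.
    by apply: le_trans (ler_norm _) _; rewrite ltW// archi_boundP.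
  - by move=> k; rewrite leNgt; apply/negP; exact: Gk.
have ubA : ubound A k0%:R.
  move=> t At; rewrite leNgt; apply/negP => k0t.
  by have := lt_le_trans Gk0 (le_trans (G_le (ltW k0t)) At); rewrite ltxx.
have supA : has_sup A by split; [exists t0|exists k0%:R].
pose t := sup A.
(* For [half_vol <= G t]: no [t + 1/(k+1)] belongs to [A], and these half-spaces decrease to the one
   at [t]. *)
exists t; apply/eqP; rewrite eq_le; apply/andP; split; last first.
  apply: (@G_decr (fun k => t + k.+1%:R^-1)).
  - move=> k l kl; rewrite lerD2l lef_pV2 ?posrE ?ltr0n// ler_nat ltnS//.
  - apply/seteqP; split=> x /=.
      move=> xk; split; first by have [] := xk 0%N I.
      apply/ler_addgt0Pl => e e0.
      have [_ /= xe] := xk (Num.truncn e^-1) I.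
      apply: le_trans xe _; rewrite addrC lerD2r.
      by rewrite invf_ple ?posrE ?ltr0n// ltW// truncnS_gt.
    move=> [Kx xt] k _; split=> //=; apply: le_trans xt _.
    by rewrite lerDl invr_ge0 ler0n.
  - move=> k; apply: ltW; rewrite ltNge; apply/negP => Ak.
    have : t + k.+1%:R^-1 <= t by apply: sup_ubound => //; exists k0%:R.
    by rewrite gerDl leNgt invr_gt0 ltr0n.
have mlt : measurable (K `&` [set x | (tnth x i : R) < t]).
  apply: measurableI => //.
  have := @measurable_coord _ _ i _ (measurable_itv `]-oo, t[).
  by congr measurable; apply/seteqP; split=> x /=; rewrite in_itv.
have meq : measurable [set x : Rn R n | (tnth x i : R) = t].
  exact: (measurable_coord i (measurable_set1 t)).
(* For [G t <= half_vol]: the boundary hyperplane is null, and the open half-space is exhausted by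
   those at [t - 1/(k+1)], each below an element of [A]. *)
apply: (@le_trans _ _ (vol (K `&` [set x | (tnth x i : R) < t]))).
  rewrite -[leRHS]adde0 -(vol_hyperplane i t).
  apply: le_trans (measureU2 _ mlt meq); apply: le_measure; rewrite ?inE.
  - exact: measurable_coord_le.
  - exact: measurableU.
  move=> x [Kx /=]; rewrite le_eqVlt => /predU1P[->|xt]; first by right.
  by left.
apply: (@G_incr (fun k => t - k.+1%:R^-1)).
- by move=> k l kl; rewrite lerD2l lerN2 lef_pV2 ?posrE ?ltr0n// ler_nat ltnS.
- apply/seteqP; split=> x /=.
    move=> [k _ [Kx /= xk]]; split=> //; apply: le_lt_trans xk _.
    by rewrite ltrBlDr ltrDl invr_gt0 ltr0n.
  move=> [Kx xt]; exists (Num.truncn (t - (tnth x i : R))^-1) => //.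
  split=> //=; rewrite lerBrDl -lerBrDr.
  by rewrite invf_ple ?posrE ?ltr0n ?subr_gt0// ltW// truncnS_gt.
- move=> k.
  have [v Av tv] : exists2 v, A v & t - k.+1%:R^-1 < v.
    by apply: sup_adherent => //; rewrite invr_gt0 ltr0n.
  exact: le_trans (G_le (ltW tv)) Av.
Qed.

End median.

(** * Cells cut out by medians and the upper bound for [psi] *)

Definition bits (R : realType) (n : nat) (t : 'I_n -> R) (x : Rn R n) :
  {ffun 'I_n -> bool} := [ffun i => t i < (tnth x i : R)].

Lemma measurable_bits (R : realType) (n : nat) (t : 'I_n -> R)
    (b : {ffun 'I_n -> bool}) :
  measurable [set x : Rn R n | bits t x = b].
Proof.
pose A i : set (measurableTypeR R) :=
  if b i then `](t i), +oo[%classic else `]-oo, (t i)]%classic.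
have -> : [set x : Rn R n | bits t x = b] =
    \bigcap_i ((fun x : Rn R n => tnth x i) @^-1` A i).
  apply/seteqP; split=> x /= => [xb i _|xA].
    by rewrite /A -xb ffunE /=; case: ltP; rewrite /= in_itv//= andbT.
  apply/ffunP => i; rewrite ffunE; have := xA i I; rewrite /A /=.
  case: (b i); rewrite /= in_itv/= ?andbT// leNgt => h.
  exact: negbTE.
apply: fin_bigcap_measurable => // i _; apply: measurable_coord.
by rewrite /A; case: ifP.
Qed.

(** Equal coordinates give equal bits; hence separated sets of cells are axis-disjoint. *)
Lemma hdist_bits_le (R : realType) (n : nat) (t : 'I_n -> R) (x y : Rn R n) :
  (hdist (bits t x) (bits t y) <= ell0 (subRn x y))%N.
Proof.
rewrite /ell0 -sum1_card [leqRHS]big_mkcond; apply: leq_sum => i _.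
rewrite !inE !ffunE tnth_mktuple subr_eq0.
have [->|_] := eqVneq (tnth x i : R) (tnth y i); first by rewrite eqxx.
by case: (_ != _).
Qed.

Lemma psi_le (R : realType) (n : nat) (K : set (Rn R n)) :
  (2 <= n)%N -> measurable K -> (0 < vol K)%E -> (vol K < +oo)%E ->
  (psi K <= (32 / Num.sqrt n%:R)%:E)%E.
Proof.
move=> n2 mK K0 Koo.
have fK : vol K \is a fin_num by rewrite ge0_fin_numE.
have V0 : 0 < fine (vol K) by rewrite fine_gt0// K0.
have [t tP] := choice (fun i => exists_median i mK K0 Koo).
pose cell b := K `&` [set x | bits t x = b].
have mcell b : measurable (cell b).
  by apply: measurableI => //; exact: measurable_bits.
pose w b := fine (vol (cell b)) / fine (vol K).
have fcell b : vol (cell b) \is a fin_num.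
  rewrite ge0_fin_numE//; apply: le_lt_trans Koo; apply: le_measure; rewrite ?inE//.
  exact: subIsetl.
have volE (P : pred {ffun 'I_n -> bool}) :
    vol (K `&` [set x | P (bits t x)]) = (fine (vol K) * \sum_(b | P b) w b)%:E.
  rewrite (@measure_preimage_fintype _ _ _ vol _ K (bits t) P mcell) mulr_sumr -sumEFin.
  by apply: eq_bigr => b _; rewrite /w mulrC divfK ?gt_eqF// fineK.
have w0 b : 0 <= w b by rewrite divr_ge0 ?fine_ge0.
have w1 : \sum_b w b = 1.
  apply: (mulfI (lt0r_neq0 V0)); apply: EFin_inj.
  rewrite -(volE xpredT) mulr1 fineK//; congr (vol _).
  by apply/seteqP; split=> x // [].
(* The false side of a bit is the closed half-space [x_i <= t_i], exactly the one halved by the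
   median; the true side follows by complement. *)
have wbal i : \sum_(b : {ffun 'I_n -> bool} | b i) w b = 1 / 2.
  have wbal' : \sum_(b : {ffun 'I_n -> bool} | ~~ b i) w b = 1 / 2.
    apply: (mulfI (lt0r_neq0 V0)); apply: EFin_inj.
    rewrite -(volE (fun b => ~~ b i)) mulrA mulr1 -(tP i).
    congr (vol (_ `&` _)); apply/seteqP; split=> x /=; rewrite ffunE -leNgt//.
  by have := w1; rewrite (bigID (fun b : {ffun 'I_n -> bool} => b i))/= wbal'; lra.
have [P [Q [sep P0 Q0 PQ]]] := exists_light_separator w0 w1 wbal n2.
pose region (P : pred {ffun 'I_n -> bool}) := K `&` [set x | P (bits t x)].
have mregion P' : measurable (region P').
  have -> : region P' = \bigcup_(b in [set b | P' b]) cell b.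
    apply/seteqP; split=> [x [Kx Px]|x [b Pb [Kx /= xb]]]; first by exists (bits t x).
    by split=> //=; rewrite xb.
  by apply: fin_bigcup_measurable => //; exact: finite_finset.
apply: ge_ereal_inf; eexists.
  exists (region P), (region Q); split; last reflexivity.
  - by split.
  - by split; exact: subIsetl.
  - move=> x y [_ Px] [_ Qy]; exact: leq_trans (sep _ _ Px Qy) (hdist_bits_le _ _ _).
  - by rewrite lt_min !volE !lte_fin !mulr_gt0.
have -> : K `\` (region P `|` region Q) = region (fun b => ~~ P b && ~~ Q b).
  apply/seteqP; split=> x /=.
    move=> [Kx nPQ]; split=> //=; rewrite -negb_or; apply/negP => /orP[Px|Qx].
      by apply: nPQ; left.
    by apply: nPQ; right.
  by move=> [Kx /= /andP[/negP nP /negP nQ]]; split=> // -[[_]|[_]].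
(* All three volumes are [vol K] times a [w]-mass, so [vol K] cancels in the ratio. *)
rewrite !volE -EFin_min -minr_pMr ?(ltW V0)//.
have m0 : 0 < Num.min (\sum_(b | P b) w b) (\sum_(b | Q b) w b) by rewrite lt_min P0.
rewrite inver gt_eqF ?mulr_gt0// -EFinM lee_fin.
have s0 : 0 < Num.sqrt n%:R :> R by rewrite sqrtr_gt0 ltr0n; lia.
rewrite -mulf_div divff ?gt_eqF// mul1r ler_pdivlMr// mulrAC ler_pdivrMr//.
by rewrite mulrC.
Qed.

(** * Comparison of the two bounds *)

Local Open Scope ereal_scope.

Theorem mainTheorem4 (R : realType) :
  exists q : R, (0 < q)%R /\
    forall (n : nat) (a : Rn R n) (h : R) (K : set (Rn R n)),
      (2 <= n)%N -> (0 < h)%R ->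
      measurable K -> 0 < vol K -> vol K < +oo ->
      psi K <= q%:E * psi (cube a h).
Proof.
(* [32 / sqrt n] is 64 times the lower bound [1 / (2 sqrt n)] for the cube. *)
exists 64%R; split=> // n a h K n2 h0 mK K0 Koo.
apply: le_trans (psi_le n2 mK K0 Koo) _.
have n0 : (0 < n)%N by lia.
have s0 : (0 < Num.sqrt n%:R :> R)%R by rewrite sqrtr_gt0 ltr0n.
apply: (@le_trans _ _ (64%:E * ((2 * Num.sqrt n%:R)^-1)%R%:E)).
  by rewrite -EFinM lee_fin le_eqVlt; apply/orP; left; apply/eqP; field; lra.
by apply: lee_wpmul2l => //; exact: psi_cube_ge.
Qed.
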